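(* Let $\mathcal{I}$ be a fair division instance with additive valuations and let $0\le\epsilon<1/4$. Let $\hat{\mathcal{I}}=\mathtt{order}(\mathtt{normalize}(\mathtt{reduce}(\mathcal{I},\epsilon)))$. Then $\hat{\mathcal{I}}$ is ordered, normalized and $\left(\frac{3}{4}+\frac{4\epsilon}{1-4\epsilon}\right)$-irreducible (i.e. it is $\frac{4\epsilon}{1-4\epsilon}$-ONI). Furthermore, for any $\alpha$, from any $\alpha$-MMS allocation of $\hat{\mathcal{I}}$ one can obtain a $\min\left(\frac{3}{4}+\epsilon,(1-4\epsilon)\alpha\right)$-MMS allocation of $\mathcal{I}$.
   Context: An instance $(N,M,\mathcal{V})$ has agents $N=[n]$, a finite set $M$ of $m$ indivisible goods, and additive valuations $v_i:2^M\to\mathbb{R}_{\ge0}$. For a valuation $v$, set $S$ and integer $d\ge1$, $\mathrm{MMS}^d_v(S)$ is the maximum over partitions $(P_1,\dots,P_d)$ of $S$ into $d$ bundles of $\min_j v(P_j)$; $\mathrm{MMS}_i=\mathrm{MMS}^n_{v_i}(M)$, and a partition attaining it is an MMS partition of $i$. An allocation gives each agent $i$ a bundle $A_i\subseteq M$ (pairwise disjoint); it is $\beta$-MMS if $v_i(A_i)\ge\beta\,\mathrm{MMS}_i$ for all $i$. An instance is ordered if $M=[m]$ and $v_i(1)\ge\dots\ge v_i(m)$ for all agents $i$; it is normalized if every agent $i$ has an MMS partition $(P^i_1,\dots,P^i_n)$ with $v_i(P^i_j)=1$ for all $j$. $\mathtt{order}(([n],[m],\mathcal{V}))=([n],[m],\mathcal{V}')$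 where $v'_i(j)$ is the $j$-th largest number in the multiset $\{v_i(g):g\in[m]\}$. $\mathtt{normalize}$: for each agent $i$ compute an MMS partition $P^i$ of $i$ and for every $j\in[n]$ and $g\in P^i_j$ set $v'_i(g)=v_i(g)/v_i(P^i_j)$. Reduction rules for an ordered instance with $n$ agents and threshold $\alpha$: $R^\alpha_1$ applicable if some agent $i$ has $v_i(\{1\})\ge\alpha$; $R^\alpha_2$ if some $i$ has $v_i(\{2n-1,2n,2n+1\})\ge\alpha$; $R^\alpha_3$ if some $i$ has $v_i(\{3n-2,\dots,3n+1\})\ge\alpha$; $R^\alpha_4$ if some $i$ has $v_i(\{1,2n+1\})\ge\alpha$; applying it gives that set to such an agent and removes the agent and the goods, re-indexing remaining goods in order. An instance is $\alpha$-irreducible if none of $R^\alpha_1,\dots,R^\alpha_4$ is applicable; it is $\delta$-ONI if ordered, normalized and $(3/4+\delta)$-irreducible. $\mathtt{reduce}(\mathcal{I},\epsilon)$: (1) replace $\mathcal{I}$ by $\mathtt{order}(\mathcal{I})$; (2) set $v_i(g)\leftarrow v_i(g)/\mathrm{MMS}_i$ for all $i,g$; (3) while some $R^{3/4+\epsilon}_k$, $k\in[4]$, is applicable, apply it for the smallest applicable $k$; output the remaining agents, goods and valuations (agents removed in (3) keep the sets given to them). *)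

(* Defs.v *)
From HB Require Import structures.
From mathcomp Require Import all_boot all_order all_algebra.
Unset Printing Implicit Defensive.
Import Order.TTheory GRing.Theory Num.Theory.
Local Open Scope ring_scope.

Section FairDivision.
Variable R : realFieldType.

(* An instance: agents 'I_na, goods 'I_ng (good g here is good g+1 of the
   paper, so M = [m] up to this 0/1-shift), valuation of agent i for good g. *)
Record inst := Inst { na : nat; ng : nat; val : 'I_na -> 'I_ng -> R }.

Definition vset (m : nat) (v : 'I_m -> R) (S : {set 'I_m}) : R :=
  \sum_(g in S) v g.

Definition bundle (m d : nat) (S : {set 'I_m}) (P : {ffun 'I_m -> 'I_d})
  (j : 'I_d) : {set 'I_m} := [set g in S | P g == j].

(* min_j v(P_j); the initial value v(S) is neutral for d >= 1 and
   nonnegative valuations, since every bundle is a subset of S. *)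
Definition pmin (m d : nat) (v : 'I_m -> R) (S : {set 'I_m})
  (P : {ffun 'I_m -> 'I_d}) : R :=
  \big[Order.min/vset m v S]_(j < d) vset m v (bundle m d S P j).

Definition MMSd (m : nat) (v : 'I_m -> R) (S : {set 'I_m}) (d : nat) : R :=
  \big[Order.max/0]_(P : {ffun 'I_m -> 'I_d}) pmin m d v S P.

Definition MMS (I : inst) (i : 'I_(na I)) : R := MMSd (ng I) (val I i) setT (na I).

Definition is_MMS_partition (I : inst) (i : 'I_(na I))
  (P : {ffun 'I_(ng I) -> 'I_(na I)}) : Prop :=
  pmin (ng I) (na I) (val I i) setT P = MMS I i.

Definition nonneg_vals (I : inst) : Prop := forall i g, 0 <= val I i g.

Definition ordered (I : inst) : Prop :=
  forall (i : 'I_(na I)) (g h : 'I_(ng I)), (g <= h)%N -> val I i h <= val I i g.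

Definition normalized (I : inst) : Prop :=
  forall i : 'I_(na I), exists P : {ffun 'I_(ng I) -> 'I_(na I)},
    is_MMS_partition I i P /\
    forall j : 'I_(na I), vset (ng I) (val I i) (bundle (ng I) (na I) setT P j) = 1.

Definition order_inst (I : inst) : inst :=
  @Inst (na I) (ng I) (fun (i : 'I_(na I)) (j : 'I_(ng I)) =>
          nth 0 (sort (fun x y : R => y <= x) [seq val I i g | g <- enum 'I_(ng I)]) j).

(* normalize_inst, given a choice of an MMS partition Ps i for every agent i *)
Definition normalize_inst (I : inst)
  (Ps : forall i : 'I_(na I), {ffun 'I_(ng I) -> 'I_(na I)}) : inst :=
  @Inst (na I) (ng I) (fun (i : 'I_(na I)) (g : 'I_(ng I)) =>
          val I i g / vset (ng I) (val I i) (bundle (ng I) (na I) setT (Ps i) (Ps i g))).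

Definition scale (I : inst) : inst :=
  @Inst (na I) (ng I) (fun (i : 'I_(na I)) (g : 'I_(ng I)) => val I i g / MMS I i).

(* The sets of the reduction rules R_1..R_4 (0-based indices of goods:
   paper good k is index k-1).  Goods with indices beyond m are treated as
   nonexistent (equivalently, dummy goods of value 0). *)
Definition rule_set (n m : nat) (k : nat) : {set 'I_m} :=
  match k with
  | 1 => [set g : 'I_m | nat_of_ord g == 0]
  | 2 => [set g : 'I_m | (2 * n - 2 <= g <= 2 * n)%N]
  | 3 => [set g : 'I_m | (3 * n - 3 <= g <= 3 * n)%N]
  | 4 => [set g : 'I_m | (nat_of_ord g == 0) || (nat_of_ord g == 2 * n)%N]
  | _ => set0
  end.

Definition rule_applies (a : R) (I : inst) (k : nat) (i : 'I_(na I)) : Prop :=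
  a <= vset (ng I) (val I i) (rule_set (na I) (ng I) k).

Definition applicable (a : R) (I : inst) (k : nat) : Prop :=
  exists i : 'I_(na I), rule_applies a I k i.

Definition irreducible_inst (a : R) (I : inst) : Prop :=
  forall k, (1 <= k <= 4)%N -> ~ applicable a I k.

(* remove agent i and the goods of T, re-indexing the rest in increasing order *)
Definition remove (I : inst) (i : 'I_(na I)) (T : {set 'I_(ng I)}) : inst :=
  @Inst #|[set~ i]| #|~: T|
    (fun (a : 'I_#|[set~ i]|) (g : 'I_#|~: T|) => val I (enum_val a) (enum_val g)).

Inductive reduce_loop (a : R) : inst -> inst -> Prop :=
| RLstop I : irreducible_inst a I -> reduce_loop a I I
| RLstep I (k : nat) (i : 'I_(na I)) I' :
    (1 <= k <= 4)%N ->
    (forall k', (1 <= k' < k)%N -> ~ applicable a I k') ->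
    rule_applies a I k i ->
    reduce_loop a (remove I i (rule_set (na I) (ng I) k)) I' ->
    reduce_loop a I I'.

Definition reduce_inst (I : inst) (eps : R) (I' : inst) : Prop :=
  reduce_loop (3 / 4 + eps) (scale (order_inst I)) I'.

Definition ONI (delta : R) (I : inst) : Prop :=
  [/\ ordered I, normalized I & irreducible_inst (3 / 4 + delta) I].

Definition is_alloc (I : inst) (A : {ffun 'I_(na I) -> {set 'I_(ng I)}}) : Prop :=
  forall i j : 'I_(na I), i != j -> [disjoint A i & A j].

Definition is_beta_MMS (I : inst) (beta : R)
  (A : {ffun 'I_(na I) -> {set 'I_(ng I)}}) : Prop :=
  forall i, beta * MMS I i <= vset (ng I) (val I i) (A i).

End FairDivision.

Arguments na {R}. Arguments ng {R}. Arguments val {R}. Arguments Inst {R}.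
Arguments MMS {R}. Arguments is_MMS_partition {R}. Arguments nonneg_vals {R}.
Arguments order_inst {R}. Arguments normalize_inst {R}. Arguments reduce_inst {R}.
Arguments ONI {R}. Arguments is_alloc {R}. Arguments is_beta_MMS {R}.
Arguments ordered {R}. Arguments normalized {R}. Arguments irreducible_inst {R}.

(* Main.v *)
Require Import Defs.
From HB Require Import structures.
From mathcomp Require Import all_boot all_order all_algebra all_fingroup.
From mathcomp Require Import zify ring lra.
Set Implicit Arguments.
Unset Strict Implicit.
Unset Printing Implicit Defensive.
Import Order.TTheory GRing.Theory Num.Theory.
Local Open Scope ring_scope.

(* Everything rests on the claim that an agent who survives the reduction
   keeps a maximin share of at least [1 - 4 eps] of its original one. Fix such
   an agent. A bundle is "nearly full" if, for some [k], it splits into a core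
   of value at least [1 - k (1/4 + eps/3)] and [k] parts of value at least
   [1/4 - eps]; its value is then at least [1 - 4 eps], because of the core
   when [k <= 3] and of the parts alone when [k >= 4]. Each rule turns a
   partition into [n] nearly full bundles into one with [n - 1]. For the first
   three, by pigeonhole, the removed goods can be traded into a single bundle
   against goods at least as valuable, and that bundle is dropped. For the
   fourth, if goods [1] and [2n+1] lie in different bundles, what is left of
   the bundle of good [1] is worth at least [1/4 - eps] since [R_1] is not
   applicable, and it replaces good [2n+1], worth at most [1/4 + eps/3] since
   [R_2] is not applicable.

   Hence normalizing multiplies values by at most [1 / (1 - 4 eps)], which
   yields irreducibility as [(3/4 + eps) / (1 - 4 eps)] is
   [3/4 + 4 eps / (1 - 4 eps)]. Allocations are carried back through
   [order_inst] by a picking sequence. *)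

(** * Sets that split into a core and parts *)

Section Split.
Variable R : realFieldType.

Lemma sum_setD (T : finType) (v : T -> R) (S E : {set T}) : E \subset S ->
  \sum_(g in S) v g = \sum_(g in E) v g + \sum_(g in S :\: E) v g.
Proof. by move=> sES; rewrite (big_setID E) /= (setIidPr sES). Qed.

Lemma ler_sum_inj (T T' : finType) (v : T -> R) (v' : T' -> R) (f : T -> T')
    (S : {set T}) (S' : {set T'}) :
  (forall g, 0 <= v' g) -> {in S &, injective f} ->
  {in S, forall g, v g <= v' (f g)} -> {in S, forall g, f g \in S'} ->
  \sum_(g in S) v g <= \sum_(g in S') v' g.
Proof.
move=> v'0 fI le_v fS.
apply: (@le_trans _ _ (\sum_(g in f @: S) v' g)).
  by rewrite big_imset //=; apply: ler_sum.
have sub : f @: S \subset S' by apply/subsetP=> _ /imsetP[g gS ->]; apply: fS.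
by rewrite (sum_setD v' sub) lerDl sumr_ge0.
Qed.

Lemma ler_sum_subset (T : finType) (v : T -> R) (S S' : {set T}) :
  (forall g, 0 <= v g) -> S \subset S' ->
  \sum_(g in S) v g <= \sum_(g in S') v g.
Proof. by move=> v0 /subsetP sS; apply: (@ler_sum_inj _ _ v v id). Qed.

(** Parts worth [d] are peeled off one at a time, which makes them disjoint without naming a family;
    what is left at the end is the core, worth [x]. *)
Fixpoint splits (T : finType) (v : T -> R) (d : R) (k : nat) (x : R)
    (S : {set T}) : Prop :=
  match k with
  | 0 => x <= \sum_(g in S) v g
  | k'.+1 => exists E : {set T}, [/\ E \subset S, d <= \sum_(g in E) v g
                                 & splits v d k' x (S :\: E)]
  end.

Lemma splits_inj (T T' : finType) (v : T -> R) (v' : T' -> R) (f : T -> T')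
    d k x (S : {set T}) (S' : {set T'}) :
  (forall g, 0 <= v' g) -> {in S &, injective f} ->
  {in S, forall g, v g <= v' (f g)} -> {in S, forall g, f g \in S'} ->
  splits v d k x S -> splits v' d k x S'.
Proof.
move=> v'0; elim: k S S' => [|k IH] S S' fI le_v fS /=.
  by move=> /le_trans; apply; apply: (@ler_sum_inj _ _ v v' f).
case=> E [/subsetP sES dE DE]; exists (f @: E); split.
- by apply/subsetP=> _ /imsetP[g gE ->]; apply: fS; apply: sES.
- apply: (le_trans dE); apply: (@ler_sum_inj _ _ v v' f) => //.
  + by move=> g h gE hE; apply: fI; apply: sES.
  + by move=> g gE; apply: le_v; apply: sES.
  + by move=> g gE; apply: imset_f.
apply: IH DE.
- by move=> g h /setDP[gS _] /setDP[hS _]; apply: fI.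
- by move=> g /setDP[gS _]; apply: le_v.
move=> g /setDP[gS gE]; rewrite inE fS // andbT.
by apply: contra gE => /imsetP[h hE /fI->] //; apply: sES.
Qed.

Lemma splits_subset (T : finType) (v : T -> R) d k x (S S' : {set T}) :
  (forall g, 0 <= v g) -> S \subset S' -> splits v d k x S -> splits v d k x S'.
Proof. by move=> v0 /subsetP sS; apply: (@splits_inj _ _ v v id). Qed.

Lemma splits_le (T : finType) (v : T -> R) d k x y (S : {set T}) :
  y <= x -> splits v d k x S -> splits v d k y S.
Proof.
move=> yx; elim: k S => [|k IH] S /=; first exact: le_trans.
by case=> E [sE dE /IH DE]; exists E.
Qed.

(** If [g] lies in the core, the core loses at most [q]; if it lies in a part, that part is given up
    and the core keeps its bound. *)
Lemma splits_rem (T : finType) (v : T -> R) d k x (S : {set T}) (g : T) q :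
  (forall g, 0 <= v g) -> v g <= q -> splits v d k x S ->
  splits v d k (x - q) (S :\ g) \/ (exists2 k', k = k'.+1 & splits v d k' x (S :\ g)).
Proof.
move=> v0 vg; elim: k S => [|k IH] S /=.
  move=> xS; left; rewrite lerBlDr.
  have [gS|gS] := boolP (g \in S).
    move: xS; rewrite (big_setD1 g gS) /=; lra.
  have -> : S :\ g = S by apply/setDidPl; rewrite disjoint_sym disjoints1.
  by have := v0 g; lra.
case=> E [sE dE DE].
have [gE|gE] := boolP (g \in E).
  right; exists k => //; apply: splits_subset DE => //.
  by apply/subsetP=> h; rewrite !inE => /andP[hE ->]; rewrite andbT; apply: contraNneq hE => ->.
have sE' : E \subset S :\ g by rewrite subsetD1 sE.
have eqS : S :\: E :\ g = (S :\ g) :\: E by apply/setP=> h; rewrite !inE andbCA.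
case: (IH _ DE); rewrite eqS; first by left; exists E.
by case=> k' -> D'; right; exists k'.+1 => //; exists E.
Qed.

Lemma splits_ge (T : finType) (v : T -> R) d k x (S : {set T}) :
  (forall g, 0 <= v g) -> splits v d k x S ->
  k%:R * d <= \sum_(g in S) v g /\ k%:R * d + x <= \sum_(g in S) v g.
Proof.
move=> v0; elim: k S => [|k IH] S /=.
  by rewrite mul0r add0r; split=> //; apply: sumr_ge0.
case=> E [sE dE /IH[]]; rewrite (sum_setD v sE) -natr1 mulrDl mul1r; lra.
Qed.

(* The shape that bundles keep while the goods are removed: each of the [k]
   losses of a good of value at most [1/4 + eps/3] has been compensated by a
   set of value at least [1/4 - eps]. *)
Definition nearly_full (eps : R) (T : finType) (v : T -> R) (S : {set T}) : Prop :=
  exists k : nat, splits v (1 / 4 - eps) k (1 - k%:R * (1 / 4 + eps / 3)) S.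

Lemma nearly_full_inj eps (T T' : finType) (v : T -> R) (v' : T' -> R)
    (f : T -> T') (S : {set T}) (S' : {set T'}) :
  (forall g, 0 <= v' g) -> {in S &, injective f} ->
  {in S, forall g, v g <= v' (f g)} -> {in S, forall g, f g \in S'} ->
  nearly_full eps v S -> nearly_full eps v' S'.
Proof. by move=> v0 fI le_v fS [k D]; exists k; apply: (splits_inj v0 fI le_v fS D). Qed.

Lemma nearly_full_subset eps (T : finType) (v : T -> R) (S S' : {set T}) :
  (forall g, 0 <= v g) -> S \subset S' ->
  nearly_full eps v S -> nearly_full eps v S'.
Proof. by move=> v0 sS [k D]; exists k; apply: (splits_subset v0 sS D). Qed.

Lemma nearly_full_ge eps (T : finType) (v : T -> R) (S : {set T}) :
  (forall g, 0 <= v g) -> 0 <= eps -> eps < 1 / 4 ->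
  nearly_full eps v S -> 1 - 4 * eps <= \sum_(g in S) v g.
Proof.
move=> v0 e0 e1 [k /(splits_ge v0)[D1 D2]].
have [k3|k4] := leqP k 3.
  have : k%:R <= 3 :> R by rewrite (ler_nat R k 3).
  (* Core and parts together are worth at least [1 - 4 k eps / 3]. *)
  by move: D2; nra.
have : 4 <= k%:R :> R by rewrite (ler_nat R 4 k).
by move: D1; nra.
Qed.

(** A part that survives the loss of [g] suffices alone. If there is none, the core suffices: it
    keeps [1 - (3/4 + eps)] when [k = 0], and [1 - (1/4 + eps/3)] when the only part was hit. *)
Lemma nearly_full_rem_ge eps (T : finType) (v : T -> R) (S : {set T}) g :
  (forall g, 0 <= v g) -> 0 <= eps -> eps < 1 / 4 -> v g <= 3 / 4 + eps ->
  nearly_full eps v S -> 1 / 4 - eps <= \sum_(h in S :\ g) v h.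
Proof.
move=> v0 e0 e1 vg [k] /(splits_rem v0 vg)[|[k' ->]] /(splits_ge v0).
  case: k => [|k]; first by rewrite !mul0r; lra.
  have : 0 <= k%:R :> R by [].
  rewrite -natr1; nra.
case: k' => [|k'']; first by rewrite !mul0r; lra.
case=> D _; apply: le_trans D; rewrite -[leLHS]mul1r; apply: ler_wpM2r; first by lra.
by rewrite (ler_nat R 1).
Qed.

(** A loss from the core is paid for by raising [k], with [E] as the new part; when [g] breaks a
    part, [E] takes its place and [k] stays. *)
Lemma nearly_full_exchange eps (T : finType) (v : T -> R) (S E : {set T}) g :
  (forall g, 0 <= v g) -> v g <= 1 / 4 + eps / 3 ->
  1 / 4 - eps <= \sum_(h in E) v h -> [disjoint S & E] ->
  nearly_full eps v S -> nearly_full eps v (E :|: S :\ g).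
Proof.
move=> v0 vg dE dis [k] /(splits_rem v0 vg) D.
have sub : S :\ g \subset (E :|: S :\ g) :\: E.
  apply/subsetP=> h; rewrite !inE => /andP[-> hS]; rewrite hS orbT andbT.
  by rewrite (disjointFr dis).
case: D => [D|[k' -> D]].
  exists k.+1; exists E; split=> //; first exact: subsetUl.
  apply: splits_subset sub _ => //; apply: splits_le D; rewrite -natr1; lra.
exists k'.+1; exists E; split=> //; first exact: subsetUl.
by apply: splits_subset sub _.
Qed.

End Split.

(** * Removing goods together with one nearly full bundle *)

Section Partition.
Variables (R : realFieldType) (eps : R).
Hypotheses (eps_ge0 : 0 <= eps) (eps_lt : eps < 1 / 4).

(* Goods with a label [n] or more lie in no bundle. *)
Definition has_partition (T : finType) (v : T -> R) (n : nat) : Prop :=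
  exists p : T -> nat, forall j, (j < n)%N -> nearly_full eps v [set g | p g == j].

Lemma has_partition_cover (T : finType) (v : T -> R) n :
  (forall g, 0 <= v g) -> has_partition v n.+1 ->
  exists p : T -> 'I_n.+1, forall j, nearly_full eps v [set g | p g == j].
Proof.
(* [inord] sends every label above [n] to bundle [0], which can only grow. *)
move=> v0 [p np]; exists (fun g => inord (p g)) => j.
apply: nearly_full_subset (np j (ltn_ord j)) => //.
by apply/subsetP=> g; rewrite !inE => /eqP->; rewrite inord_val.
Qed.

(** No bundle other than [a] meets [D], so all of them survive the re-indexing of goods. Exchanging
    the labels [a] and [n] then leaves exactly the labels below [n] in use for them. *)
Lemma has_partition_drop (T : finType) (v : T -> R) n (D : {set T})
    (p : T -> nat) a :
  (forall g, 0 <= v g) -> (a < n.+1)%N ->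
  (forall j, (j < n.+1)%N -> j != a ->
     nearly_full eps v [set g | p g == j] /\ {in D, forall g, p g != j}) ->
  has_partition (fun g : 'I_#|~: D| => v (enum_val g)) n.
Proof.
move=> v0 an np.
pose tp b := if b == a then n else if b == n then a else b.
exists (fun g => tp (p (enum_val g))) => j jn.
have [tpn tpa tpK] : [/\ (tp j < n.+1)%N, tp j != a & tp (tp j) = j].
  rewrite {1 2 4}/tp (ltn_eqF jn); case: (eqVneq j a) => [ja|ja].
    by rewrite /tp eqxx; case: eqP => [|_]; split; lia.
  by rewrite /tp (negbTE ja) (ltn_eqF jn); split=> //; lia.
have [nf nD] := np _ tpn tpa.
(* [enum_rank_in] needs a good outside [D]; the bundle provides one, since its value is positive. *)
have [x0 x0S] : exists x, x \in [set g | p g == tp j].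
  apply/set0Pn; apply/eqP => S0; have := nearly_full_ge v0 eps_ge0 eps_lt nf.
  by rewrite S0 big_set0; move: eps_lt; lra.
have inC g : p g = tp j -> g \in ~: D.
  by move=> pg; rewrite inE; apply/negP=> /nD; rewrite pg eqxx.
have x0D : x0 \in ~: D by apply: inC; apply/eqP; rewrite inE in x0S.
apply: (nearly_full_inj (f := enum_rank_in x0D)) nf => //.
- move=> g h; rewrite !inE => /eqP/inC gD /eqP/inC hD /(congr1 enum_val).
  by rewrite !enum_rankK_in.
- by move=> g; rewrite inE => /eqP/inC gD; rewrite enum_rankK_in.
- move=> g; rewrite !inE => /eqP pg; rewrite enum_rankK_in ?inC //.
  by rewrite pg tpK.
Qed.

Lemma pigeonhole_fiber (T : finType) n (p : T -> 'I_n) (U : {set T}) s :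
  (n * s < #|U|)%N -> exists a, (s < #|[set x in U | p x == a]|)%N.
Proof.
move=> lt_ns; apply/existsP; apply: contraTT lt_ns.
rewrite negb_exists -leqNgt => /forallP le.
rewrite -sum1_card (partition_big p xpredT) //= mulnC -[n in (s * n)%N]card_ord.
rewrite mulnC -sum_nat_const; apply: leq_sum => a _; rewrite sum1dep_card.
by have := le a; rewrite -leqNgt.
Qed.

Lemma ex_subset_card (T : finType) (X : {set T}) s :
  (s <= #|X|)%N -> exists2 U : {set T}, U \subset X & #|U| = s.
Proof.
move=> sX; exists [set x in take s (enum X)].
  by apply/subsetP=> x; rewrite inE => /mem_take; rewrite mem_enum.
rewrite cardsE; have /card_uniqP-> : uniq (take s (enum X)).
  by rewrite take_uniq // enum_uniq.
by rewrite size_takel // -cardE.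
Qed.

(** Induction on the number of goods of [D] outside [U]: one such [t] is traded for some [u] in [U]
    outside [D]. The bundle giving [t] away receives a good at least as valuable, so only bundle [a]
    can lose. *)
Lemma nearly_full_swap (T : finType) (v : T -> R) n (p : T -> 'I_n) a
    (U D : {set T}) :
  (forall g, 0 <= v g) -> #|U| = #|D| ->
  (forall u t, u \in U :\: D -> t \in D :\: U -> v t <= v u) ->
  {in U, forall u, p u = a} ->
  exists2 p' : T -> 'I_n, {in D, forall t, p' t = a} &
    forall j, j != a -> nearly_full eps v [set g | p g == j] ->
      nearly_full eps v [set g | p' g == j].
Proof.
move=> v0; have [k] := ubnP #|D :\: U|; elim: k => // k IH in U p *.
rewrite ltnS => leDk eqUD leUD pU.
have [|[t tDU]] := set_0Vmem (D :\: U).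
  move/eqP; rewrite setD_eq0 => /subsetP sDU.
  by exists p => // t /sDU; apply: pU.
have [|[u uUD]] := set_0Vmem (U :\: D).
  move=> UD0; have : #|D :\: U| = 0%N.
    by have := cardsID U D; have := cardsID D U; rewrite setIC UD0 cards0; lia.
  by rewrite (cardD1 t) tDU.
have [tD tU] := setDP tDU; have [uU uD] := setDP uUD.
have tu : t != u by apply: contraNneq tU => ->.
have DU' : D :\: (t |: U :\ u) = (D :\: U) :\ t.
  apply/setP=> x; rewrite !inE; case: (eqVneq x u) => [->|_] /=.
    by rewrite (negbTE uD) !andbF.
  by rewrite negb_or andbA.
have [||x y|x|p' p'D np'] := IH (t |: U :\ u) (p \o tperm t u).
- by move: leDk; rewrite DU' (cardsD1 t) tDU; lia.
- rewrite cardsU1 !inE (negbTE tU) andbF /= -eqUD (cardsD1 u U) uU; lia.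
- rewrite DU' => /setDP[+ xD]; rewrite !inE.
  case/orP=> [/eqP xt|/andP[xu xU]]; first by rewrite xt tD in xD.
  by move=> /and3P[yt yU yD]; apply: leUD; rewrite inE ?xD ?yU.
- rewrite !inE /= => /orP[/eqP->|/andP[xu xU]]; first by rewrite tpermL pU.
  by rewrite tpermD ?pU 1?eq_sym //; apply: contraTneq xU => ->.
exists p' => // j ja nf; apply: np' => //.
apply: (nearly_full_inj (f := tperm t u)) nf => //.
- by move=> x y _ _; apply: perm_inj.
- move=> x; rewrite inE; case: tpermP => [-> _|-> pu|//]; first exact: leUD.
  by rewrite -(eqP pu) pU ?eqxx in ja.
- by move=> x; rewrite !inE /= tpermK.
Qed.

(** The count forces some bundle to hold [#|D|] goods of [U], which are traded for those of [D].
    With [D] empty there is nothing to trade and any bundle may be dropped. *)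
Lemma has_partition_remove_top (T : finType) (v : T -> R) n (U D : {set T}) :
  (forall g, 0 <= v g) -> has_partition v n.+1 -> D \subset U ->
  (forall u t, u \in U :\: D -> t \in D -> v t <= v u) ->
  (n.+1 * #|D|.-1 < #|U|)%N || (#|D| == 0)%N ->
  has_partition (fun g : 'I_#|~: D| => v (enum_val g)) n.
Proof.
move=> v0 /(has_partition_cover v0)[p np] sDU leUD cardU.
have [a Ua] : exists a, (#|D| <= #|[set x in U | p x == a]|)%N.
  case: posnP cardU => [->|D0]; first by exists ord0.
  rewrite orbF => /(pigeonhole_fiber p)[a ?]; exists a.
  by rewrite -(prednK D0).
have [W /subsetP sWU cW] := ex_subset_card Ua.
have [||p' p'D np'] := @nearly_full_swap _ v _ p a W D v0 cW.
- move=> u t /setDP[/sWU]; rewrite inE => /andP[uU _] uD /setDP[tD _].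
  by apply: leUD => //; rewrite inE uD.
- by move=> u /sWU; rewrite inE => /andP[_ /eqP].
apply: (@has_partition_drop _ v n D (fun g => p' g : nat) a) => // j jn ja.
pose j' := Ordinal jn; have j'a : j' != a by [].
split; last by move=> g /p'D ->; rewrite eq_sym.
exact: np' j' j'a (np j').
Qed.

Lemma has_partition_remove_pair (T : finType) (v : T -> R) n (g h : T) :
  (forall x, 0 <= v x) -> has_partition v n.+1 -> g != h ->
  v g <= 3 / 4 + eps -> v h <= 1 / 4 + eps / 3 ->
  has_partition (fun x : 'I_#|~: [set g; h]| => v (enum_val x)) n.
Proof.
move=> v0 /(has_partition_cover v0)[p np] gh vg vh.
have [pgh|pgh] := eqVneq (p g) (p h).
  apply: (@has_partition_drop _ v n _ (fun x => p x : nat) (p g)) => // j jn ja.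
  split; first exact: np (Ordinal jn).
  by move=> x; rewrite !inE => /orP[]/eqP->; rewrite -?pgh eq_sym.
(* Both goods go to the bundle of [g], which is dropped; the rest of that bundle moves to the bundle
   of [h] and compensates for the loss of [h]. *)
pose p2 x := if (x == g) || (x == h) then p g else if p x == p g then p h else p x.
apply: (@has_partition_drop _ v n _ (fun x => p2 x : nat) (p g)) => // j jn ja.
pose j' := Ordinal jn; have j'a : j' != p g by [].
split; last by move=> x; rewrite !inE /p2 => ->; rewrite eq_sym.
have [jh|jh] := eqVneq j' (p h); last first.
  apply: nearly_full_subset (np j') => //; apply/subsetP=> x.
  rewrite !inE /p2 => /eqP px; case: ifP => [/orP[]/eqP xE|_].
  - by rewrite -px xE eqxx in j'a.
  - by rewrite -px xE eqxx in jh.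
  by rewrite px (negbTE j'a).
have dE := nearly_full_rem_ge v0 eps_ge0 eps_lt vg (np (p g)).
have dis : [disjoint [set x | p x == p h] & [set x | p x == p g] :\ g].
  apply/pred0P=> x /=; rewrite !inE; case: eqP => //= ->.
  by rewrite [p h == _]eq_sym (negbTE pgh) andbF.
apply: nearly_full_subset (nearly_full_exchange v0 vh dE dis (np (p h))) => //.
apply/subsetP=> x; rewrite !inE /p2 -[j]/(j' : nat) jh.
case/orP=> /andP[xg px].
  have xh : x != h by apply: contraTneq px => ->; rewrite eq_sym.
  by rewrite (negbTE xg) (negbTE xh) px eqxx.
have xg' : x != g by apply: contraTneq px => ->.
by rewrite (negbTE xg) (negbTE xg') (eqP px) [p h == _]eq_sym (negbTE pgh) eqxx.
Qed.

End Partition.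

(** * The reduction rules and their loop *)

Section Reduction.
Variables (R : realFieldType) (eps : R).
Hypotheses (eps_ge0 : 0 <= eps) (eps_lt : eps < 1 / 4).

Lemma card_ord_lt m k : #|[set g : 'I_m | (g < k)%N]| = minn m k.
Proof.
rewrite cardE -(size_map (@nat_of_ord m)).
rewrite (perm_size (_ : perm_eq _ (iota 0 (minn m k)))) ?size_iota //.
apply: uniq_perm; rewrite ?iota_uniq ?map_inj_uniq ?enum_uniq //; first exact: val_inj.
move=> x; rewrite mem_iota add0n leq_min /=; apply/mapP/andP => [[g]|[xm xk]].
  by rewrite mem_enum inE => gk ->; rewrite ltn_ord.
by exists (Ordinal xm) => //; rewrite mem_enum inE.
Qed.

(** [remove] re-indexes goods by [enum_val]; its monotonicity keeps the reduced instances
    ordered. *)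
Lemma enum_val_homo m (A : {set 'I_m}) (i j : 'I_#|A|) :
  (i <= j)%N -> (enum_val i <= enum_val j)%N.
Proof.
have x0 := enum_val i; rewrite !(enum_val_nth x0) => ij.
pose le_ord := relpre (@nat_of_ord m) leq.
have le_tr : transitive le_ord by move=> x y z; apply: leq_trans.
have le_refl : reflexive le_ord by move=> x; apply: leqnn.
apply: (sorted_leq_nth le_tr le_refl); rewrite ?inE -?cardE //.
rewrite {1}/enum_mem; apply: sorted_filter => //.
by rewrite -enumT -sorted_map val_enum_ord iota_sorted.
Qed.

Definition nonincreasing m (v : 'I_m -> R) := forall g h : 'I_m, (g <= h)%N -> v h <= v g.

(** For [r = 0, 2, 3] and [n.+1] agents these are the goods of the first three rules. Among the
    first [r * n.+1 + 1] goods, [r + 1] share a bundle, as many as the interval has. *)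
Lemma has_partition_remove_interval n m (v : 'I_m -> R) r :
  (forall g, 0 <= v g) -> nonincreasing v -> has_partition eps v n.+1 ->
  has_partition eps (fun g : 'I_#|~: [set g : 'I_m | (r * n <= g <= r * n.+1)%N]| =>
                       v (enum_val g)) n.
Proof.
move=> v0 vm vp; set D := [set g | _].
have DE : D = [set g : 'I_m | (g < (r * n.+1).+1)%N] :\: [set g : 'I_m | (g < r * n)%N].
  by apply/setP=> g; rewrite !inE -leqNgt ltnS.
have cD : #|D| = (minn m (r * n.+1).+1 - minn m (r * n))%N.
  rewrite DE cardsD (setIidPr _) ?card_ord_lt //.
  by apply/subsetP=> g; rewrite !inE; nia.
apply: (@has_partition_remove_top _ _ eps_ge0 eps_lt _ v n
  [set g : 'I_m | (g < (r * n.+1).+1)%N]) => //.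
- by rewrite DE subsetDl.
- move=> u t; rewrite !inE => /andP[uD ur] /andP[tr _]; apply: vm.
  by move: uD; rewrite negb_and -!ltnNge; lia.
- rewrite cD card_ord_lt (mulnS r); have [h1|h1] := leqP (r + r * n).+1 m.
    rewrite (minn_idPr _); last by lia.
    by rewrite -addSn addnK; apply/orP; left; rewrite /= mulSn mulnC.
  have [h2|h2] := leqP (r * n) m; last first.
    by rewrite subnn orbT.
  (* The goods run out inside the interval: only [s <= r] of its goods exist, and all [m] goods
     serve as the top ones. *)
  have [s sE] : exists s, m = (r * n + s)%N.
    by exists (m - r * n)%N; lia.
  rewrite sE addKn in h1 *; case: s {sE} h1 => [|s] h1; first by rewrite orbT.
  by rewrite orbF /=; nia.
Qed.

Lemma has_partition_remove_rule n m (v : 'I_m -> R) k :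
  (forall g, 0 <= v g) -> nonincreasing v -> has_partition eps v n.+1 ->
  (1 <= k <= 4)%N ->
  (forall k', (1 <= k' < k)%N -> vset R m v (rule_set n.+1 m k') <= 3 / 4 + eps) ->
  has_partition eps (fun g : 'I_#|~: rule_set n.+1 m k| => v (enum_val g)) n.
Proof.
move=> v0 vm vp k14 irr.
have ruleE (r k' : nat) :
    rule_set n.+1 m k' = [set g : 'I_m | (r * n <= g <= r * n.+1)%N] ->
    has_partition eps (fun g : 'I_#|~: rule_set n.+1 m k'| => v (enum_val g)) n.
  by move=> ->; apply: has_partition_remove_interval.
case: k k14 irr => [|[|[|[|[|k]]]]] // _ irr.
- by apply: (ruleE 0%N); apply/setP=> g; rewrite !inE leqn0.
- by apply: (ruleE 2%N); apply/setP=> g; rewrite !inE; congr (_ && _); lia.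
- by apply: (ruleE 3%N); apply/setP=> g; rewrite !inE; congr (_ && _); lia.
have [mn|nm] := leqP m (2 * n.+1).
  (* Index [2 * n.+1] is out of range, so the fourth rule takes the same goods as the first. *)
  apply: (ruleE 0%N); apply/setP=> g; rewrite !inE leqn0.
  by rewrite orbC; case: eqP => //; have := ltn_ord g; lia.
have m0 : (0 < m)%N by lia.
pose g0 := Ordinal m0; pose g1 := Ordinal nm.
have -> : rule_set n.+1 m 4 = [set g0; g1] by apply/setP=> g; rewrite !inE.
apply: has_partition_remove_pair => //.
- have := irr 1%N isT; have -> : rule_set n.+1 m 1 = [set g0].
    by apply/setP=> g; rewrite !inE.
  by rewrite /vset big_set1.
(* [g1] is the last, hence least valuable, of the three goods of the second rule, so it is worth at
   most a third of [3/4 + eps]. *)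
have p1 : (2 * n < m)%N by lia.
have p2 : (2 * n + 1 < m)%N by lia.
have := irr 2%N isT.
have -> : rule_set n.+1 m 2 = Ordinal p1 |: (Ordinal p2 |: [set g1]).
  by apply/setP=> g; rewrite !inE -!val_eqE /=; lia.
rewrite /vset big_setU1 ?inE -?val_eqE /=; last by lia.
rewrite big_setU1 ?inE -?val_eqE /=; last by lia.
rewrite big_set1.
have : v g1 <= v (Ordinal p1) by apply: vm => /=; lia.
have : v g1 <= v (Ordinal p2) by apply: vm => /=; lia.
lra.
Qed.

Definition reducible_invariant (I : inst R) : Prop :=
  [/\ nonneg_vals I, ordered I & forall i, has_partition eps (Defs.val I i) (na I)].

Lemma reduce_loop_invariant I I' :
  reduce_loop R (3 / 4 + eps) I I' -> reducible_invariant I -> reducible_invariant I'.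
Proof.
elim=> // {I I'}I k i I' k14 irr app _ IH [v0 vo vp]; apply: IH; split.
- by move=> j g; apply: v0.
- by move=> j g h gh; apply: vo; apply: enum_val_homo.
move=> j; set i' := enum_val j.
have [n nE] : exists n, na I = n.+1.
  by exists (na I).-1; rewrite prednK //; apply: leq_ltn_trans (ltn_ord i).
have irr' k' : (1 <= k' < k)%N ->
    vset R _ (Defs.val I i') (rule_set (na I) (ng I) k') <= 3 / 4 + eps.
  move=> kk'; rewrite leNgt; apply/negP=> lt.
  by apply: (irr _ kk'); exists i'; apply: ltW.
move: (v0 i') (vo i') (vp i') irr'; rewrite /= cardsC1 card_ord -/i'.
move: (Defs.val I i') => v; rewrite nE => v0' vo' vp' irr'.
exact: has_partition_remove_rule.
Qed.

Lemma reduce_loop_irreducible (a : R) I I' :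
  reduce_loop R a I I' -> irreducible_inst a I'.
Proof. by elim. Qed.

(** The rounds are undone one by one. An agent served by a rule has value [a]; any other is traced
    to its index [i'] in the final instance. *)
Lemma reduce_loop_alloc (a : R) I I' : reduce_loop R a I I' ->
  nonneg_vals I -> forall A' : {ffun 'I_(na I') -> {set 'I_(ng I')}}, is_alloc I' A' ->
  exists2 A : {ffun 'I_(na I) -> {set 'I_(ng I)}}, is_alloc I A &
    forall i, a <= vset R _ (Defs.val I i) (A i) \/
      exists i', vset R _ (Defs.val I' i') (A' i') <= vset R _ (Defs.val I i) (A i).
Proof.
elim=> [{}I _ _ A' alA'|{}I k i {}I' k14 _ app _ IH v0 A' alA'].
  by exists A' => // i; right; exists i.
have [|B alB geB] := IH _ A' alA'; first by move=> j g; apply: v0.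
set T := rule_set _ _ _ in B alB geB *.
(* An agent without a preimage under [enum_val] is the removed agent [i], who keeps [T]. *)
pose A := [ffun j => if [pick j' : 'I_#|[set~ i]| | enum_val j' == j] is Some j'
                     then (@enum_val _ (mem (~: T))) @: B j' else T].
have AP j : (exists2 j' : 'I_#|[set~ i]|, enum_val j' = j &
               A j = (@enum_val _ (mem (~: T))) @: B j') \/ (j = i /\ A j = T).
  rewrite /A ffunE; case: pickP => [j' /eqP <-|nj]; first by left; exists j'.
  right; split=> //; have [//|ji] := eqVneq j i.
  have jC : j \in [set~ i] by rewrite !inE.
  by have := nj (enum_rank_in jC j); rewrite enum_rankK_in // eqxx.
have disT (S : {set 'I_#|~: T|}) : [disjoint T & (@enum_val _ (mem (~: T))) @: S].
  apply/pred0P=> x /=; apply/negP=> /andP[xT /imsetP[y _ xE]].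
  by have := enum_valP y; rewrite -xE inE xT.
exists A.
  move=> j1 j2; case: (AP j1) => [[j1' <- ->]|[-> ->]]; case: (AP j2) => [[j2' <- ->]|[-> ->]].
  - move=> ne; have ne' : j1' != j2' by apply: contraNneq ne => ->.
    by rewrite imset_disjoint ?alB //; apply: enum_val_inj.
  - by move=> _; rewrite disjoint_sym disT.
  - by move=> _; apply: disT.
  - by rewrite eqxx.
move=> j; case: (AP j) => [[j' <- ->]|[-> ->]]; last by left.
have le_B : vset R _ (Defs.val (remove R I i T) j') (B j') <=
            vset R _ (Defs.val I (enum_val j')) ((@enum_val _ (mem (~: T))) @: B j').
  apply: (ler_sum_inj (f := @enum_val _ (mem (~: T)))) => //.
  - by move=> x y _ _; apply: enum_val_inj.
  - by move=> x; apply: imset_f.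
case: (geB j') => [geBj|[i' geBj]]; first by left; apply: le_trans geBj _.
by right; exists i'; apply: le_trans geBj _.
Qed.

End Reduction.

(** * Maximin shares, sorting and picking sequences *)

Section MaximinShare.
Variable R : realFieldType.

Lemma pmin_le_bundle m d (v : 'I_m -> R) S P j :
  pmin R m d v S P <= vset R m v (bundle m d S P j).
Proof. exact: bigmin_le. Qed.

Lemma pmin_ge m d (v : 'I_m -> R) (P : {ffun 'I_m -> 'I_d}) x :
  (forall g, 0 <= v g) -> (0 < d)%N ->
  (forall j, x <= vset R m v (bundle m d setT P j)) -> x <= pmin R m d v setT P.
Proof.
move=> v0 d0 xP; apply: le_bigmin => //; apply: le_trans (xP (Ordinal d0)) _.
exact: ler_sum_subset (subsetT _).
Qed.

Lemma MMSd_ge m d (v : 'I_m -> R) (P : {ffun 'I_m -> 'I_d}) x :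
  (forall g, 0 <= v g) -> (0 < d)%N ->
  (forall j, x <= vset R m v (bundle m d setT P j)) -> x <= MMSd R m v setT d.
Proof.
move=> v0 d0 xP; apply: le_trans (pmin_ge v0 d0 xP) _.
exact: le_bigmax.
Qed.

(** The iterated maximum starts from [0]; positivity excludes this default, so a partition attains
    it. *)
Lemma MMSd_attained m d (v : 'I_m -> R) S : 0 < MMSd R m v S d ->
  exists P : {ffun 'I_m -> 'I_d}, forall j,
    MMSd R m v S d <= vset R m v (bundle m d S P j).
Proof.
move=> M0; suff [P MP] : exists P, MMSd R m v S d = pmin R m d v S P.
  by exists P => j; rewrite MP pmin_le_bundle.
suff [M|//] : MMSd R m v S d = 0 \/ exists P, MMSd R m v S d = pmin R m d v S P.
  by rewrite M ltxx in M0.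
rewrite /MMSd; elim/big_ind: _ => [|x y Hx Hy|P _]; first by left.
  by rewrite maxEle; case: ifP.
by right; exists P.
Qed.

Lemma sum_bundle m d (v : 'I_m -> R) (P : {ffun 'I_m -> 'I_d}) :
  \sum_j vset R m v (bundle m d setT P j) = \sum_g v g.
Proof.
rewrite [RHS](partition_big P xpredT) //=; apply: eq_bigr => j _.
by apply: eq_bigl => g; rewrite !inE.
Qed.

(** The total value is [d], so the least of [d] bundles never exceeds the average [1]. *)
Lemma unit_bundles_MMSd m d (v : 'I_m -> R) (P : {ffun 'I_m -> 'I_d}) :
  (forall g, 0 <= v g) -> (0 < d)%N ->
  (forall j, vset R m v (bundle m d setT P j) = 1) ->
  pmin R m d v setT P = 1 /\ MMSd R m v setT d = 1.
Proof.
move=> v0 d0 P1.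
have tot : \sum_g v g = d%:R.
  by rewrite -(sum_bundle v P) (eq_bigr _ (fun j _ => P1 j)) sumr_const card_ord.
have le1 (Q : {ffun 'I_m -> 'I_d}) : pmin R m d v setT Q <= 1.
  have : \sum_(j < d) pmin R m d v setT Q <= d%:R.
    by rewrite -tot -(sum_bundle v Q); apply: ler_sum => j _; apply: pmin_le_bundle.
  by rewrite sumr_const card_ord -[X in X <= _]mulr_natr -ler_pdivlMr ?ltr0n // divff // pnatr_eq0 -lt0n.
split; apply/eqP; rewrite eq_le.
  by rewrite le1 pmin_ge // => j; rewrite P1.
rewrite (MMSd_ge (P := P)) // ?andbT => [|j]; last by rewrite P1.
by apply: bigmax_le.
Qed.

Lemma vset_bundle_perm m d (v : 'I_m -> R) (s : {perm 'I_m}) (P : {ffun 'I_m -> 'I_d}) j :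
  vset R m (v \o s) (bundle m d setT [ffun g => P (s g)] j) =
  vset R m v (bundle m d setT P j).
Proof.
rewrite /vset [RHS](reindex_inj (@perm_inj _ s)) /=.
by apply: eq_bigl => g; rewrite !inE ffunE.
Qed.

Lemma MMSd_perm_le m d (v : 'I_m -> R) (s : {perm 'I_m}) :
  (forall g, 0 <= v g) -> (0 < d)%N -> 0 < MMSd R m v setT d ->
  MMSd R m v setT d <= MMSd R m (v \o s) setT d.
Proof.
move=> v0 d0 /MMSd_attained[P MP].
apply: (@MMSd_ge _ _ _ [ffun g => P (s g)]) => // j; first by apply: v0.
by rewrite vset_bundle_perm.
Qed.

Lemma eq_MMSd m d (v w : 'I_m -> R) : v =1 w -> MMSd R m v setT d = MMSd R m w setT d.
Proof.
move=> vw; apply: eq_bigr => P _; rewrite /pmin /vset (eq_bigr _ (fun g _ => vw g)).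
by apply: eq_bigr => j _; apply: eq_bigr => g _.
Qed.

Lemma sort_perm m (v : 'I_m -> R) : exists s : {perm 'I_m}, forall j : 'I_m,
  nth 0 (sort (fun x y : R => y <= x) [seq v g | g <- enum 'I_m]) j = v (s j).
Proof.
pose t := [tuple v g | g < m].
have /tuple_permP[s sE] : perm_eq (sort (fun x y : R => y <= x) t) t by rewrite perm_sort.
exists s => j.
have -> : [seq v g | g <- enum 'I_m] = t by rewrite /t /=.
by rewrite sE -tnth_nth tnth_mktuple tnth_mktuple.
Qed.

Lemma order_inst_perm (I : inst R) i : exists s : {perm 'I_(ng I)},
  forall j, Defs.val (order_inst I) i j = Defs.val I i (s j).
Proof. exact: sort_perm. Qed.

Lemma order_inst_ordered (I : inst R) : ordered (order_inst I).
Proof.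
move=> i g h gh /=; set r := (fun x y : R => y <= x).
apply: (@sorted_leq_nth _ r) => //.
- by move=> x y z xy yz; apply: le_trans yz xy.
- by move=> x; apply: lexx.
- by apply: sort_sorted => x y; apply: le_total.
- by rewrite inE size_sort size_map -cardE card_ord; apply: ltn_ord.
- by rewrite inE size_sort size_map -cardE card_ord; apply: ltn_ord.
Qed.

Lemma order_inst_nonneg (I : inst R) : nonneg_vals I -> nonneg_vals (order_inst I).
Proof. by move=> v0 i g; have [s ->] := order_inst_perm i. Qed.

Lemma MMS_order_inst (I : inst R) i :
  nonneg_vals I -> 0 < MMS I i -> MMS (order_inst I) i = MMS I i.
Proof.
move=> v0 M0; have [s sE] := order_inst_perm i.
have n0 : (0 < na I)%N by apply: leq_ltn_trans (ltn_ord i).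
have E : MMS (order_inst I) i = MMSd R _ (Defs.val I i \o s) setT (na I).
  exact: eq_MMSd.
have le1 : MMS I i <= MMSd R _ (Defs.val I i \o s) setT (na I).
  by apply: MMSd_perm_le => //; apply: v0.
rewrite E; apply/eqP; rewrite eq_le le1 andbT.
(* The converse inequality is the same lemma for the inverse permutation. *)
have -> : MMS I i = MMSd R _ ((Defs.val I i \o s) \o (s^-1)%g) setT (na I).
  by apply: eq_MMSd => g /=; rewrite permKV.
apply: MMSd_perm_le => //; first by move=> g; apply: v0.
exact: lt_le_trans le1.
Qed.

(** The first [j + 1] positions cannot all be sent below [j], so some [l <= j] has [s l >= j]; then
    [v (s j) <= v (s l) <= u (s l) <= u j]. *)
Lemma nonincreasing_perm_le m (v u : 'I_m -> R) (s : {perm 'I_m}) :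
  nonincreasing (v \o s) -> nonincreasing u -> (forall g, v g <= u g) ->
  forall j, v (s j) <= u j.
Proof.
move=> vs um vu j.
have [l lj js] : exists2 l : 'I_m, (l <= j)%N & (j <= s l)%N.
  apply/exists_inP; apply: contraT; rewrite negb_exists_in => /forall_inP sl.
  have : (#|s @: [set l : 'I_m | l < j.+1]| <= #|[set l : 'I_m | l < j]|)%N.
    apply/subset_leq_card/subsetP=> _ /imsetP[l + ->]; rewrite !inE ltnS => /sl.
    by rewrite -ltnNge.
  rewrite card_imset; last exact: perm_inj.
  by rewrite !card_ord_lt; have := ltn_ord j; lia.
apply: le_trans (vs _ _ lj) _; apply: le_trans (vu _) _; exact: um.
Qed.

(* Picking sequence: the chooser of round [j] finds one of its [j + 1] best
   goods untaken. *)
Lemma picking_sequence m (w : 'I_m -> 'I_m -> R) (s : 'I_m -> {perm 'I_m}) :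
  (forall j, nonincreasing (w j \o s j)) ->
  exists2 f : 'I_m -> 'I_m, injective f & forall j, w j (s j j) <= w j (f j).
Proof.
move=> wm.
have pick_upto k : (k <= m)%N -> exists2 f : 'I_m -> 'I_m,
    {in [pred j : 'I_m | (j < k)%N] &, injective f} &
    {in [pred j : 'I_m | (j < k)%N], forall j, w j (s j j) <= w j (f j)}.
  elim: k => [|k IH] km; first by exists id.
  have [f fI fP] := IH (ltnW km); pose K := Ordinal km.
  have /subsetPn[x /imsetP[l lk xE] xf] :
      ~~ (s K @: [set j : 'I_m | j < k.+1]%N \subset f @: [set j : 'I_m | j < k]%N).
    apply/negP=> /subset_leq_card; rewrite card_imset; last exact: perm_inj.
    rewrite leqNgt => /negP; apply; apply: leq_ltn_trans (leq_imset_card _ _) _.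
    by rewrite !card_ord_lt; lia.
  rewrite inE ltnS in lk.
  have lt_k (j : 'I_m) : (j < k.+1)%N -> j != K -> (j < k)%N.
    by rewrite -val_eqE /=; lia.
  have nx (j : 'I_m) : (j < k)%N -> f j != x.
    by move=> jk; apply: contraNneq xf => <-; apply: imset_f; rewrite inE.
  exists (fun j => if j == K then x else f j).
    move=> g h; rewrite !inE => gk hk.
    case: (eqVneq g K) => [->|gK]; case: (eqVneq h K) => [->|hK] //.
    - by move=> /esym/eqP; rewrite (negbTE (nx _ (lt_k _ hk hK))).
    - by move=> /eqP; rewrite (negbTE (nx _ (lt_k _ gk gK))).
    - by apply: fI; rewrite inE lt_k.
  move=> j; rewrite inE => jk; case: (eqVneq j K) => [->|jK].
    by rewrite xE; apply: (wm K l K).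
  by apply: fP; rewrite inE lt_k.
have [f fI fP] := pick_upto m (leqnn m).
exists f; first by move=> g h; apply: fI; rewrite inE.
by move=> j; apply: fP; rewrite inE.
Qed.

(** Round [j] of a picking sequence belongs to the owner of the ordered good [j], who picks an
    original good worth at least as much. *)
Lemma unorder_alloc (I : inst R) (A : {ffun 'I_(na I) -> {set 'I_(ng I)}}) :
  nonneg_vals I -> is_alloc (order_inst I) A ->
  exists2 B : {ffun 'I_(na I) -> {set 'I_(ng I)}}, is_alloc I B &
    forall i, vset R _ (Defs.val (order_inst I) i) (A i) <= vset R _ (Defs.val I i) (B i).
Proof.
move=> v0 alA.
have /fin_all_exists[s sE] := @order_inst_perm I.
pose owner j := [pick i | j \in A i].
have ownerE i j : j \in A i -> owner j = Some i.
  move=> jA; rewrite /owner; case: pickP => [i' jA'|/(_ i)]; last by rewrite jA.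
  have [->//|ne] := eqVneq i' i.
  by have := disjointFr (alA _ _ ne) jA'; rewrite jA.
(* Rounds of unowned goods get the zero valuation, for which any pick will do. *)
pose w j := if owner j is Some i then Defs.val I i else fun=> 0.
pose t j := if owner j is Some i then s i else 1%g.
have [j|f fI fP] := @picking_sequence _ w t.
  rewrite /w /t; case: (owner j) => [i|] g h gh //=.
  by rewrite -!sE; apply: order_inst_ordered.
exists [ffun i => f @: A i].
  by move=> i j ij; rewrite !ffunE imset_disjoint //; apply: alA.
move=> i; rewrite ffunE; apply: (ler_sum_inj (f := f)).
- exact: v0.
- by move=> x y _ _; apply: fI.
- by move=> j /ownerE jE; have := fP j; rewrite /w /t jE -sE.
- by move=> j; apply: imset_f.
Qed.

End MaximinShare.

(** * Normalizing by partitions whose bundles are worth at least [c] *)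

Section Normalize.
Variables (R : realFieldType) (I : inst R) (c : R).
Variable Ps : forall i : 'I_(na I), {ffun 'I_(ng I) -> 'I_(na I)}.
Hypotheses (v0 : nonneg_vals I) (c_gt0 : 0 < c).
Hypothesis Ps_ge : forall i j,
  c <= vset R _ (Defs.val I i) (bundle (ng I) (na I) setT (Ps i) j).

Let N := normalize_inst I Ps.

Lemma normalize_inst_nonneg : nonneg_vals N.
Proof. by move=> i g; rewrite divr_ge0 //; apply: le_trans (ltW c_gt0) _. Qed.

Lemma normalize_inst_le i g : Defs.val N i g <= Defs.val I i g / c.
Proof.
rewrite ler_wpM2l // lef_pV2 // ?posrE //.
exact: lt_le_trans (Ps_ge i _).
Qed.

Lemma order_normalize_unit_bundles (i : 'I_(na I)) :
  exists P : {ffun 'I_(ng I) -> 'I_(na I)}, forall j,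
    vset R _ (Defs.val (order_inst N) i) (bundle (ng I) (na I) setT P j) = 1.
Proof.
have [s sE] := @order_inst_perm _ N i; exists [ffun g => Ps i (s g)] => j.
transitivity (vset R _ (Defs.val N i) (bundle (ng I) (na I) setT (Ps i) j)).
  by rewrite -[RHS](vset_bundle_perm _ s); rewrite /vset; apply: eq_bigr => g _; apply: sE.
set B := bundle _ _ _ _ _.
have B0 : vset R _ (Defs.val I i) B != 0 by rewrite gt_eqF //; apply: lt_le_trans c_gt0 (Ps_ge i j).
rewrite -[RHS](divff B0) {2}/vset mulr_suml; apply: eq_bigr => g.
by rewrite !inE /= => /eqP ->.
Qed.

Lemma order_normalize_normalized : normalized (order_inst N).
Proof.
move=> i; have [P P1] := order_normalize_unit_bundles i; exists P; split=> //.
have n0 : (0 < na I)%N by apply: leq_ltn_trans (ltn_ord i).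
have [E1 E2] := unit_bundles_MMSd (order_inst_nonneg normalize_inst_nonneg i) n0 P1.
exact: etrans E1 (esym E2).
Qed.

Lemma MMS_order_normalize i : MMS (order_inst N) i = 1.
Proof.
have [P P1] := order_normalize_unit_bundles i.
have n0 : (0 < na I)%N by apply: leq_ltn_trans (ltn_ord i).
exact: (unit_bundles_MMSd (order_inst_nonneg normalize_inst_nonneg i) n0 P1).2.
Qed.

(** Normalizing may destroy the order, and sorting then moves goods to other positions; the bound by
    [1 / c] still holds position by position because [I] is ordered. *)
Lemma order_normalize_le i j : ordered I ->
  Defs.val (order_inst N) i j <= Defs.val I i j / c.
Proof.
move=> oI; have [s sE] := @order_inst_perm _ N i; rewrite sE.
apply: (@nonincreasing_perm_le _ _ (Defs.val N i) (fun g => Defs.val I i g / c) s).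
- by move=> g h gh; have := @order_inst_ordered _ N i g h gh; rewrite !sE.
- by move=> g h gh; rewrite ler_wpM2r ?invr_ge0 ?(ltW c_gt0) //; apply: oI.
- exact: normalize_inst_le.
Qed.

(** Rule sets depend only on the numbers of agents and goods, so a rule applicable at [a / c] after
    normalizing would apply to [I] at [a]. *)
Lemma order_normalize_irreducible (a : R) :
  ordered I -> irreducible_inst a I -> irreducible_inst (a / c) (order_inst N).
Proof.
move=> oI irr k k14 [i ai]; apply: (irr k k14); exists i.
rewrite /rule_applies -(ler_pM2r (x := c^-1)) ?invr_gt0 //; apply: le_trans ai _.
by rewrite /vset mulr_suml; apply: ler_sum => g _; apply: order_normalize_le.
Qed.

Lemma order_normalize_alloc (A : {ffun 'I_(na I) -> {set 'I_(ng I)}}) :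
  is_alloc (order_inst N) A ->
  exists2 B : {ffun 'I_(na I) -> {set 'I_(ng I)}}, is_alloc I B &
    forall i, c * vset R _ (Defs.val (order_inst N) i) (A i)
              <= vset R _ (Defs.val I i) (B i).
Proof.
case/(unorder_alloc normalize_inst_nonneg) => B alB AB; exists B => // i.
rewrite mulrC -ler_pdivlMr //; apply: le_trans (AB i) _.
by rewrite /vset mulr_suml; apply: ler_sum => g _; apply: normalize_inst_le.
Qed.

End Normalize.

(** * Shares before and after the reduction, and the transfer of allocations *)

Lemma scale_order_invariant (R : realFieldType) (eps : R) (I : inst R) :
  nonneg_vals I -> (forall i, 0 < MMS I i) ->
  reducible_invariant eps (scale R (order_inst I)).
Proof.
move=> v0 M0.
have M0' i : 0 < MMS (order_inst I) i by rewrite MMS_order_inst.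
split.
- by move=> i g; apply: divr_ge0 (ltW (M0' i)); apply: order_inst_nonneg.
- move=> i g h gh; apply: ler_wpM2r; first by rewrite invr_ge0 ltW.
  exact: order_inst_ordered.
move=> i; have [P MP] := MMSd_attained (M0' i).
(* After scaling, the bundles of an optimal partition are worth at least [1], so they are nearly
   full with [k = 0]. *)
exists (fun g => P g : nat) => j jn; exists 0%N; rewrite /= mul0r subr0.
rewrite -mulr_suml ler_pdivlMr // mul1r; apply: le_trans (MP (Ordinal jn)) _.
by rewrite /vset le_eqVlt; apply/orP; left; apply/eqP; apply: eq_bigl => g; rewrite !inE.
Qed.

Lemma has_partition_MMS (R : realFieldType) (eps : R) (I : inst R) i :
  0 <= eps -> eps < 1 / 4 -> nonneg_vals I ->
  has_partition eps (Defs.val I i) (na I) -> 1 - 4 * eps <= MMS I i.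
Proof.
case: I i => [[|n] m v] i e0 e1 v0; first by case: i.
case/(has_partition_cover (v0 i))=> p np.
apply: (@MMSd_ge _ _ _ _ [ffun g => p g]) => // j.
apply: le_trans (nearly_full_ge (v0 i) e0 e1 (np j)) _.
by rewrite /vset le_eqVlt; apply/orP; left; apply/eqP; apply: eq_bigl => g; rewrite !inE ffunE.
Qed.

Theorem theorem14 (R : realFieldType) (I : inst R) (eps : R) :
  nonneg_vals I ->
  (forall i : 'I_(na I), 0 < MMS I i) ->
  0 <= eps -> eps < 1 / 4 ->
  forall Ired : inst R, reduce_inst I eps Ired ->
  forall Ps : forall i : 'I_(na Ired), {ffun 'I_(ng Ired) -> 'I_(na Ired)},
  (forall i, is_MMS_partition Ired i (Ps i)) ->
  let Ih := order_inst (normalize_inst Ired Ps) in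
  ONI (4 * eps / (1 - 4 * eps)) Ih /\
  exists F : {ffun 'I_(na Ih) -> {set 'I_(ng Ih)}} ->
             {ffun 'I_(na I) -> {set 'I_(ng I)}},
    forall (alpha : R) (A : {ffun 'I_(na Ih) -> {set 'I_(ng Ih)}}),
      is_alloc Ih A -> is_beta_MMS Ih alpha A ->
      is_alloc I (F A) /\
      is_beta_MMS I (Order.min (3 / 4 + eps) ((1 - 4 * eps) * alpha)) (F A).
Proof.
move=> v0 M0 e0 e1 J red Ps PsP Ih.
have inv0 := scale_order_invariant eps v0 M0.
have [J0 oJ pJ] := reduce_loop_invariant e0 e1 red inv0.
have c0 : 0 < 1 - 4 * eps by lra.
have Ps_ge i j : 1 - 4 * eps <= vset R _ (Defs.val J i) (bundle (ng J) (na J) setT (Ps i) j).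
  apply: le_trans (has_partition_MMS e0 e1 J0 (pJ i)) _.
  by rewrite -PsP; apply: pmin_le_bundle.
split.
  split.
  - exact: order_inst_ordered.
  - exact: (order_normalize_normalized J0 c0 Ps_ge).
  have -> : 3 / 4 + 4 * eps / (1 - 4 * eps) = (3 / 4 + eps) / (1 - 4 * eps).
    by field; rewrite gt_eqF.
  exact: (order_normalize_irreducible J0 c0 Ps_ge oJ (reduce_loop_irreducible red)).
(* [F] depends on [A] alone, so the bundles are chosen before [alpha] is introduced. *)
have /fin_all_exists[F FP] : forall A : {ffun 'I_(na Ih) -> {set 'I_(ng Ih)}},
  exists B : {ffun 'I_(na I) -> {set 'I_(ng I)}}, is_alloc Ih A -> is_alloc I B /\
    forall alpha, is_beta_MMS Ih alpha A ->
      is_beta_MMS I (Order.min (3 / 4 + eps) ((1 - 4 * eps) * alpha)) B.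
  move=> A; case: (boolP [forall i, forall j, (i != j) ==> [disjoint A i & A j]]) => [|nA].
    (* If [A] is not an allocation the claim is vacuous and any value of [F] serves. *)
    2: exists [ffun=> set0] => alA; case/negP: nA; apply/forallP=> i; apply/forallP=> j.
    2: by apply/implyP; apply: alA.
  move=> /forallP alA'; have alA : is_alloc Ih A.
    by move=> i j; have /forallP/(_ j)/implyP := alA' i.
  (* The allocation is carried back through normalization with its sorting, then the reduction, then
     the initial sorting. *)
  have [A1 alA1 geA1] := order_normalize_alloc J0 c0 Ps_ge alA.
  have [S0 _ _] := inv0.
  have [A2 alA2 geA2] := reduce_loop_alloc red S0 alA1.
  have [B alB geB] := @unorder_alloc _ I A2 v0 alA2.
  exists B => _; split=> // alpha geA i.
  have Mi : 0 < MMS (order_inst I) i by rewrite MMS_order_inst.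
  rewrite -(MMS_order_inst v0 (M0 i)); apply: le_trans (geB i).
  rewrite -ler_pdivlMr //.
  have -> : vset R _ (Defs.val (order_inst I) i) (A2 i) / MMS (order_inst I) i
          = vset R _ (Defs.val (scale R (order_inst I)) i) (A2 i).
    by rewrite /vset mulr_suml.
  (* Agents served by a rule meet the first term of the minimum; survivors meet the second, as every
     maximin share in [Ih] is [1]. *)
  rewrite ge_min; case: (geA2 i) => [->//|[i' le_i]]; apply/orP; right.
  apply: le_trans le_i; apply: le_trans (geA1 i'); rewrite ler_pM2l //.
  by have := geA i'; rewrite (MMS_order_normalize J0 c0 Ps_ge) mulr1.
by exists F => alpha A alA geA; have [? ge] := FP A alA; split=> //; apply: ge.
Qed.
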